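(* Let $\mu\in(0,\tfrac12]$, $\gamma=1-2\mu$, let $\epsilon,A_2,W_1$ be real parameters of sufficiently small absolute value, let $n>0$ with $n^2=1+\tfrac32A_2$, and let $E,F,G$ be the real numbers given in the context. Consider on $\mathbb{R}^4$, with canonical coordinates $(x,y,p_x,p_y)$, the quadratic Hamiltonian $$H_2=\frac{p_x^2+p_y^2}{2}+n(yp_x-xp_y)+Ex^2+Fy^2+Gxy .$$ Suppose that $$D=4(E+F+n^2)^2-4\bigl\{4EF-G^2+n^4-2n^2(E+F)\bigr\}>0$$ and that the roots of the characteristic equation $$\lambda^4+2(E+F+n^2)\lambda^2+4EF-G^2+n^4-2n^2(E+F)=0$$ are $\pm i\omega_1,\pm i\omega_2$ with $0<\omega_2<\frac1{\sqrt2}<\omega_1<1$. Then there is a real $4\times4$ matrix $J$ such that the linear change of variables $$(x,y,p_x,p_y)^{T}=J\,(Q_1,Q_2,P_1,P_2)^{T}$$ is canonical (symplectic) and, upon setting $$Q_i=\Bigl(\frac{2I_i}{\omega_i}\Bigr)^{1/2}\sin\phi_i,\qquad P_i=(2I_i\omega_i)^{1/2}\cos\phi_i\qquad(i=1,2),$$ the Hamiltonian $H_2$ takes the normal form $$H_2=\omega_1I_1-\omega_2I_2 .$$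
   Context: The Hamiltonian $H_2$ is the second-order part, at the triangular equilibrium point $L_4$ (shifted to the origin), of the Hamiltonian of the planar generalized photogravitational restricted three body problem with Poynting-Robertson drag. Here $\mu=m_2/(m_1+m_2)\le\frac12$ is the mass parameter of the primaries, $q_1=1-\epsilon$ with $|\epsilon|\ll1$ is the mass reduction factor of the radiating bigger primary, $A_2$ is the oblateness coefficient of the smaller primary, $W_1=(1-\mu)(1-q_1)/c_d$ is the Poynting-Robertson drag coefficient ($c_d$ being the dimensionless speed of light), $n$ is the mean motion, and $\gamma=1-2\mu$. The parameters $\epsilon$, $A_2$, $W_1$ are treated as small. The coefficients are $$E=\frac1{16}\Bigl\{2-6\epsilon-3A_2-\frac{31A_2\epsilon}{2}-\frac{(69+\gamma)}{6\sqrt3}nW_1+\frac{2(307+75\gamma)\epsilon}{27\sqrt3}nW_1+\gamma\Bigl[2\epsilon+12A_2+\frac{A_2\epsilon}{3}+\frac{(199+17\gamma)}{6\sqrt3}nW_1-\frac{2(226+99\gamma)\epsilon}{27\sqrt3}nW_1\Bigr]\Bigr\},$$ $$F=-\frac1{16}\Bigl\{10-2\epsilon+21A_2-\frac{717A_2\epsilon}{18}-\frac{(67+19\gamma)}{6\sqrt3}nW_1+\frac{2(413-3\gamma)\epsilon}{27\sqrt3}nW_1+\gamma\Bigl[6\epsilon-\frac{293A_2\epsilon}{18}+\frac{(187+27\gamma)}{6\sqrt3}nW_1-\frac{4(247+3\gamma)\epsilon}{27\sqrt3}nW_1\Bigr]\Bigr\},$$ $$G=\frac{\sqrt3}{8}\Bigl\{2\epsilon+6A_2-\frac{37A_2\epsilon}{2}-\frac{(13+\gamma)}{2\sqrt3}nW_1+\frac{2(79-7\gamma)\epsilon}{27\sqrt3}nW_1-\gamma\Bigl[6-\frac{\epsilon}{3}+13A_2-\frac{33A_2\epsilon}{2}+\frac{(11-\gamma)}{2\sqrt3}nW_1-\frac{(186-\gamma)\epsilon}{9\sqrt3}nW_1\Bigr]\Bigr\}.$$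 The characteristic equation in the claim is that of the linear Hamiltonian system generated by $H_2$. ''Canonical'' means that the linear map preserves the standard symplectic form, i.e. $dx\wedge dp_x+dy\wedge dp_y=dQ_1\wedge dP_1+dQ_2\wedge dP_2$. The variables $I_i\ge0$ and $\phi_i$ are action and angle variables. *)

(* Defs.v *)
From mathcomp Require Import all_boot all_order all_algebra.
From mathcomp Require Import reals trigo.
From mathcomp.real_closed Require Import complex.

Set Implicit Arguments.
Unset Strict Implicit.
Unset Printing Implicit Defensive.

Import Order.TTheory GRing.Theory Num.Theory.
Local Open Scope ring_scope.

Section Definitions.
Variable R : realType.

Definition H2coefE (gamma eps A2 n W1 : R) : R :=
  1 / 16 *
  (2 - 6 * eps - 3 * A2 - 31 * A2 * eps / 2
   - (69 + gamma) / (6 * Num.sqrt 3) * n * W1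
   + 2 * (307 + 75 * gamma) * eps / (27 * Num.sqrt 3) * n * W1
   + gamma * (2 * eps + 12 * A2 + A2 * eps / 3
              + (199 + 17 * gamma) / (6 * Num.sqrt 3) * n * W1
              - 2 * (226 + 99 * gamma) * eps / (27 * Num.sqrt 3) * n * W1)).

Definition H2coefF (gamma eps A2 n W1 : R) : R :=
  - (1 / 16) *
  (10 - 2 * eps + 21 * A2 - 717 * A2 * eps / 18
   - (67 + 19 * gamma) / (6 * Num.sqrt 3) * n * W1
   + 2 * (413 - 3 * gamma) * eps / (27 * Num.sqrt 3) * n * W1
   + gamma * (6 * eps - 293 * A2 * eps / 18
              + (187 + 27 * gamma) / (6 * Num.sqrt 3) * n * W1
              - 4 * (247 + 3 * gamma) * eps / (27 * Num.sqrt 3) * n * W1)).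

Definition H2coefG (gamma eps A2 n W1 : R) : R :=
  Num.sqrt 3 / 8 *
  (2 * eps + 6 * A2 - 37 * A2 * eps / 2
   - (13 + gamma) / (2 * Num.sqrt 3) * n * W1
   + 2 * (79 - 7 * gamma) * eps / (27 * Num.sqrt 3) * n * W1
   - gamma * (6 - eps / 3 + 13 * A2 - 33 * A2 * eps / 2
              + (11 - gamma) / (2 * Num.sqrt 3) * n * W1
              - (186 - gamma) * eps / (9 * Num.sqrt 3) * n * W1)).

(* Phase space is 'cV[R]_4; the coordinates are ordered positions first, as
   (x, y, p_x, p_y), resp. (Q_1, Q_2, P_1, P_2). *)
Definition col4 (a b c d : R) : 'cV[R]_4 := \col_i [:: a; b; c; d]`_i.

Definition H2 (n E F G : R) (z : 'cV[R]_4) : R :=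
  let x := z 0 0 in let y := z 1 0 in
  let px := z 2 0 in let py := z 3 0 in
  (px ^+ 2 + py ^+ 2) / 2 + n * (y * px - x * py)
  + E * x ^+ 2 + F * y ^+ 2 + G * x * y.

(* dx /\ dp_x + dy /\ dp_y evaluated on the pair (u, v) *)
Definition symplectic_form (u v : 'cV[R]_4) : R :=
  (u 0 0 * v 2 0 - u 2 0 * v 0 0) + (u 1 0 * v 3 0 - u 3 0 * v 1 0).

Definition canonical (J : 'M[R]_4) : Prop :=
  forall u v : 'cV[R]_4,
    symplectic_form (J *m u) (J *m v) = symplectic_form u v.

Definition actionQ (w I phi : R) : R := Num.sqrt (2 * I / w) * sin phi.
Definition actionP (w I phi : R) : R := Num.sqrt (2 * I * w) * cos phi.

End Definitions.

(* Main.v *)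
Require Import Defs.
From mathcomp Require Import all_boot all_order all_algebra.
From mathcomp Require Import reals trigo.
From mathcomp.real_closed Require Import complex.
From mathcomp Require Import ring lra.

Set Implicit Arguments.
Unset Strict Implicit.
Unset Printing Implicit Defensive.

Import Order.TTheory GRing.Theory Num.Theory.
Local Open Scope ring_scope.
Local Open Scope complex_scope.

(** The normal form is determined by the frequencies: it is built from the
    eigenvectors of the linear system, by formulas in [n], [E], [F], [G] that
    give a real symplectic matrix as soon as [4 * n ^+ 2 > 1].

    Put [X = w1 ^+ 2], [Y = w2 ^+ 2].  Vieta's formulas give
    [X + Y = 2 * (E + F + n ^+ 2)] and [X * Y = c].  Let [A] be the matrix of the
    Hamiltonian vector field of [H2].  An eigenvector of [A] for the eigenvalue
    [i w] is [q + i w p], where, with [M = w ^+ 2 + n ^+ 2 - 2 * F],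
      [q = (M, G, - n G, n (M - 2 w ^+ 2))] and
      [p = (0, 2 n, M - 2 n ^+ 2, G)],
    so that [A q = - w ^+ 2 p] and [A p = q].  The planes of the two modes are
    orthogonal for the symplectic form, and the form takes on [(q, p)] the value
    [M1 * (X - Y)] for the first mode and [- M2 * (X - Y)] for the second.

    The signs of these values decide the signs in the normal form, and they
    follow from [4 * n ^+ 2 > 1] ([mode_factor_gt0]).  The characteristic
    equation reads
    [M2 * (4 * n ^+ 2 - M1) = G ^+ 2 + 4 * n ^+ 2 * Y > 0], and
    [M1 - M2 = X - Y < 1 < 4 * n ^+ 2]; hence [M2 > 0], and then [M1 > 0].
    The bases of both planes can thus be rescaled by real factors, with a
    change of sign of [p] in the second, to form a symplectic basis: these are
    the columns of [J].  The change of sign is the minus sign of the normal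
    form.

    The energy of the modes needs no computation: [H2 z] is half the
    symplectic form evaluated on [(A z, z)], so that a canonical [J] which
    carries the field of [w1 I1 - w2 I2] to that of [H2] also carries one
    Hamiltonian to the other ([H2_canonical]). *)

(** * Symplectic linear algebra in dimension four *)

Lemma col4E (R : realType) (a b c d : R) :
  (col4 a b c d 0 0 = a) * (col4 a b c d 1 0 = b) *
  (col4 a b c d 2 0 = c) * (col4 a b c d 3 0 = d).
Proof. by rewrite !mxE. Qed.

Lemma eq_col4 (R : realType) (u v : 'cV[R]_4) :
  u 0 0 = v 0 0 -> u 1 0 = v 1 0 -> u 2 0 = v 2 0 -> u 3 0 = v 3 0 -> u = v.
Proof.
move=> e0 e1 e2 e3; apply/colP; case=> [[|[|[|[|//]]]] lti].
- by rewrite (_ : Ordinal lti = 0) //; apply: val_inj.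
- by rewrite (_ : Ordinal lti = 1) //; apply: val_inj.
- by rewrite (_ : Ordinal lti = 2) //; apply: val_inj.
- by rewrite (_ : Ordinal lti = 3) //; apply: val_inj.
Qed.

Definition cols_mx (R : realType) (c0 c1 c2 c3 : 'cV[R]_4) : 'M[R]_4 :=
  \matrix_(i, j) [:: c0; c1; c2; c3]`_j i 0.

Lemma cols_mxE (R : realType) (c0 c1 c2 c3 z : 'cV[R]_4) :
  cols_mx c0 c1 c2 c3 *m z
  = z 0 0 *: c0 + z 1 0 *: c1 + z 2 0 *: c2 + z 3 0 *: c3.
Proof.
apply/colP => i; rewrite !mxE !big_ord_recl big_ord0 !mxE /=.
have -> : lift ord0 (ord0 : 'I_3) = 1 :> 'I_4 by apply: val_inj.
have -> : lift ord0 (lift ord0 (ord0 : 'I_2)) = 2 :> 'I_4 by apply: val_inj.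
have -> : lift ord0 (lift ord0 (lift ord0 (ord0 : 'I_1))) = 3 :> 'I_4
  by apply: val_inj.
by rewrite (_ : ord0 = 0) //; ring.
Qed.

Lemma canonical_cols (R : realType) (q1 q2 p1 p2 : 'cV[R]_4) :
  symplectic_form q1 p1 = 1 -> symplectic_form q2 p2 = 1 ->
  symplectic_form q1 q2 = 0 -> symplectic_form p1 p2 = 0 ->
  symplectic_form q1 p2 = 0 -> symplectic_form q2 p1 = 0 ->
  canonical (cols_mx q1 q2 p1 p2).
Proof.
move=> h11 h22 hq hp h12 h21 u v; rewrite !cols_mxE.
pose m (i j : 'I_4) := u i 0 * v j 0 - u j 0 * v i 0.
transitivity (m 0 2 * symplectic_form q1 p1 + m 1 3 * symplectic_form q2 p2
  + m 0 1 * symplectic_form q1 q2 + m 2 3 * symplectic_form p1 p2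
  + m 0 3 * symplectic_form q1 p2 + m 1 2 * symplectic_form q2 p1).
  by rewrite /m /symplectic_form !mxE; ring.
by rewrite h11 h22 hq hp h12 h21 /m /symplectic_form; ring.
Qed.

(** * The Hamiltonian vector fields *)

Definition H2_field (R : realType) (n E F G : R) (z : 'cV[R]_4) : 'cV[R]_4 :=
  let x := z 0 0 in let y := z 1 0 in
  let px := z 2 0 in let py := z 3 0 in
  col4 (px + n * y) (py - n * x)
       (n * py - 2 * E * x - G * y) (- n * px - 2 * F * y - G * x).

(** The field of [(P1^2 + w1^2 Q1^2) / 2 - (P2^2 + w2^2 Q2^2) / 2], which is
    [w1 I1 - w2 I2] in action-angle variables. *)
Definition normal_field (R : realType) (w1 w2 : R) (z : 'cV[R]_4) :
  'cV[R]_4 :=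
  col4 (z 2 0) (- z 3 0) (- w1 ^+ 2 * z 0 0) (w2 ^+ 2 * z 1 0).

(** Euler's identity for a homogeneous function of degree two. *)
Lemma H2_symplecticE (R : realType) (n E F G : R) (z : 'cV[R]_4) :
  H2 n E F G z = symplectic_form (H2_field n E F G z) z / 2.
Proof. by rewrite /H2 /symplectic_form /H2_field !col4E; field. Qed.

Lemma H2_field_comb (R : realType) (n E F G : R) (a b c d : R)
    (u v w z : 'cV[R]_4) :
  H2_field n E F G (a *: u + b *: v + c *: w + d *: z)
  = a *: H2_field n E F G u + b *: H2_field n E F G v
    + c *: H2_field n E F G w + d *: H2_field n E F G z.
Proof.
by rewrite /H2_field; apply: eq_col4; rewrite !col4E !mxE /=; ring.
Qed.

(** A linear symplectic map that conjugates the vector fields conjugates the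
    Hamiltonians, since a quadratic Hamiltonian is recovered from its field. *)
Lemma H2_canonical (R : realType) (n E F G w1 w2 : R) (J : 'M[R]_4) :
  canonical J ->
  (forall z, H2_field n E F G (J *m z) = J *m normal_field w1 w2 z) ->
  forall z : 'cV[R]_4,
    H2 n E F G (J *m z) = (z 2 0 ^+ 2 + w1 ^+ 2 * z 0 0 ^+ 2) / 2
                        - (z 3 0 ^+ 2 + w2 ^+ 2 * z 1 0 ^+ 2) / 2.
Proof.
move=> canJ fieldJ z; rewrite H2_symplecticE fieldJ canJ.
by rewrite /symplectic_form /normal_field !col4E; field.
Qed.

Lemma oscillator_energy (R : realType) (w I phi : R) : 0 < w -> 0 <= I ->
  (actionP w I phi ^+ 2 + w ^+ 2 * actionQ w I phi ^+ 2) / 2 = w * I.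
Proof.
move=> w0 I0; have wN0 := lt0r_neq0 w0.
rewrite /actionP /actionQ !exprMn !sqr_sqrtr.
- transitivity (w * I * (cos phi ^+ 2 + sin phi ^+ 2)); first by field.
  by rewrite cos2Dsin2 mulr1.
- by rewrite divr_ge0 ?mulr_ge0 // ltW.
- by rewrite !mulr_ge0 // ltW.
Qed.

(** * The two modes *)

(** [modeQ s n G M X] and [modeP s n G M] are [s] times the real part, and
    [s / w] times the imaginary part, of an eigenvector for [i w] with
    [X = w ^+ 2].  Dividing the imaginary part by [w] makes all entries
    polynomial in [X]. *)
Definition modeQ (R : realType) (s n G M X : R) : 'cV[R]_4 :=
  col4 (s * M) (s * G) (- (s * n * G)) (s * n * (M - 2 * X)).

Definition modeP (R : realType) (s n G M : R) : 'cV[R]_4 :=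
  col4 0 (s * (2 * n)) (s * (M - 2 * n ^+ 2)) (s * G).

(** The second hypothesis is the characteristic equation, written as the
    vanishing of the determinant of the linear system for [(x, y)]. *)
Lemma H2_field_modeQ (R : realType) (s n E F G M X : R) :
  M = X + n ^+ 2 - 2 * F ->
  M * (X + n ^+ 2 - 2 * E) = G ^+ 2 + 4 * n ^+ 2 * X ->
  H2_field n E F G (modeQ s n G M X) = - X *: modeP s n G M.
Proof.
move=> MX char_eq; rewrite /H2_field /modeQ /modeP.
apply: eq_col4; rewrite !col4E mxE !col4E.
- by ring.
- by ring.
- transitivity (s * (M * (X + n ^+ 2 - 2 * E) - G ^+ 2 - 2 * n ^+ 2 * X
                     - X * M)); first by ring.
  by rewrite char_eq; ring.
- by rewrite MX; ring.
Qed.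

Lemma H2_field_modeP (R : realType) (s n E F G M X : R) :
  M = X + n ^+ 2 - 2 * F ->
  H2_field n E F G (modeP s n G M) = modeQ s n G M X.
Proof.
move=> ->; rewrite /H2_field /modeQ /modeP.
by apply: eq_col4; rewrite !col4E; ring.
Qed.

Lemma symplectic_modeQQ (R : realType) (s t n G M X N Y : R) :
  symplectic_form (modeQ s n G M X) (modeQ t n G N Y)
  = 2 * s * t * n * G * ((X - Y) - (M - N)).
Proof. by rewrite /symplectic_form /modeQ !col4E; ring. Qed.

Lemma symplectic_modePP (R : realType) (s t n G M N : R) :
  symplectic_form (modeP s n G M) (modeP t n G N) = 0.
Proof. by rewrite /symplectic_form /modeP !col4E; ring. Qed.

Lemma symplectic_modeQP (R : realType) (s t n G M X N : R) :
  symplectic_form (modeQ s n G M X) (modeP t n G N)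
  = s * t * (M * (N - 4 * n ^+ 2) + (G ^+ 2 + 4 * n ^+ 2 * X)).
Proof. by rewrite /symplectic_form /modeQ /modeP !col4E; ring. Qed.

(** By Vieta's formulas the other factor [X + n ^+ 2 - 2 * E] of the
    characteristic equation is [4 * n ^+ 2 - M2], where [M2] belongs to the
    other frequency. *)
Lemma other_factor (R : realType) (n E F X Y : R) :
  X + Y = 2 * (E + F + n ^+ 2) ->
  X + n ^+ 2 - 2 * E = 4 * n ^+ 2 - (Y + n ^+ 2 - 2 * F).
Proof. by move=> sXY; lra. Qed.

Lemma char_eq_factored (R : realType) (n E F G X Y : R) :
  X + Y = 2 * (E + F + n ^+ 2) ->
  X * Y = 4 * E * F - G ^+ 2 + n ^+ 4 - 2 * n ^+ 2 * (E + F) ->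
  (X + n ^+ 2 - 2 * F) * (X + n ^+ 2 - 2 * E) = G ^+ 2 + 4 * n ^+ 2 * X.
Proof.
move=> sXY pXY; have YE : Y = 2 * (E + F + n ^+ 2) - X by rewrite -sXY; ring.
have -> : G ^+ 2 = 4 * E * F + n ^+ 4 - 2 * n ^+ 2 * (E + F) - X * Y.
  by rewrite pXY; ring.
by rewrite YE; ring.
Qed.

(** The symplectic form restricted to the plane of the first mode has the sign
    of [M1], on that of the second the opposite of the sign of [M2]; so
    positivity of both is what fixes the signs [w1 I1 - w2 I2].  If [M2] were
    not positive, the characteristic equation would force [M2 < 0], and
    [4 * n ^+ 2 - M1] would be negative as well, against [M1 = M2 + (X - Y) < 4 * n ^+ 2]. *)
Lemma mode_factor_gt0 (R : realType) (n G M1 M2 X Y : R) :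
  0 < n -> 0 < Y -> Y < X -> X - Y < 4 * n ^+ 2 -> M1 - M2 = X - Y ->
  M2 * (4 * n ^+ 2 - M1) = G ^+ 2 + 4 * n ^+ 2 * Y ->
  0 < M1 /\ 0 < M2.
Proof.
move=> n0 Y0 YX ltn M12 char_eq.
have prod_gt0 : 0 < M2 * (4 * n ^+ 2 - M1).
  rewrite char_eq ltr_wpDl ?sqr_ge0 // !mulr_gt0 // exprn_gt0 //.
have M2_gt0 : 0 < M2.
  rewrite ltNge; apply/negP => M2_le0.
  have fac_ge0 : 0 <= 4 * n ^+ 2 - M1 by lra.
  by have := mulr_le0_ge0 M2_le0 fac_ge0; rewrite leNgt prod_gt0.
by split=> //; lra.
Qed.

Lemma normal_form_exists (R : realType) (n E F G w1 w2 : R) :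
  0 < n -> 0 < w2 -> w2 < w1 -> w1 ^+ 2 - w2 ^+ 2 < 4 * n ^+ 2 ->
  w1 ^+ 2 + w2 ^+ 2 = 2 * (E + F + n ^+ 2) ->
  w1 ^+ 2 * w2 ^+ 2 = 4 * E * F - G ^+ 2 + n ^+ 4 - 2 * n ^+ 2 * (E + F) ->
  exists2 J : 'M[R]_4, canonical J &
    forall z, H2_field n E F G (J *m z) = J *m normal_field w1 w2 z.
Proof.
move=> n0 w20 w21; have Y0 : 0 < w2 ^+ 2 by rewrite exprn_gt0.
have YX : w2 ^+ 2 < w1 ^+ 2 by rewrite ltr_pXn2r ?nnegrE // ltW // (lt_trans w20).
rewrite /normal_field.
move: (w1 ^+ 2) (w2 ^+ 2) Y0 YX => X Y Y0 YX ltn sXY pXY.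
have sYX : Y + X = 2 * (E + F + n ^+ 2) by rewrite addrC.
have pYX : Y * X = 4 * E * F - G ^+ 2 + n ^+ 4 - 2 * n ^+ 2 * (E + F).
  by rewrite mulrC.
have charX := char_eq_factored sXY pXY; have charY := char_eq_factored sYX pYX.
have facX := other_factor sXY; have facY := other_factor sYX.
set M1 := X + n ^+ 2 - 2 * F in charX facY *.
set M2 := Y + n ^+ 2 - 2 * F in charY facX *.
have M12 : M1 - M2 = X - Y by rewrite /M1 /M2; ring.
have charY' := charY; rewrite facY in charY'.
have charX' := charX; rewrite facX in charX'.
have [M1_gt0 M2_gt0] := mode_factor_gt0 n0 Y0 YX ltn M12 charY'.
have scale M : 0 < M -> exists s : R, s * s * (M * (X - Y)) = 1.
  move=> M0; have k0 : 0 < M * (X - Y) by rewrite mulr_gt0 // subr_gt0.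
  exists (Num.sqrt (M * (X - Y)))^-1.
  rewrite -invfM -expr2 sqr_sqrtr ?ltW // mulVf //; exact: lt0r_neq0.
have [s1 s1E] := scale _ M1_gt0; have [s2 s2E] := scale _ M2_gt0.
(* The sign in front of s2 reverses the orientation of the plane on which the
   Hamiltonian is negative. *)
exists (cols_mx (modeQ s1 n G M1 X) (modeQ s2 n G M2 Y)
                (modeP s1 n G M1) (modeP (- s2) n G M2)).
  apply: canonical_cols;
    rewrite ?symplectic_modeQQ ?symplectic_modePP ?symplectic_modeQP
            -?charX' -?charY' ?M12; try ring.
  - by rewrite -s1E -M12; ring.
  - by rewrite -s2E -M12; ring.
move=> z; rewrite !cols_mxE H2_field_comb !col4E.
rewrite (H2_field_modeQ _ (erefl M1) charX) (H2_field_modeQ _ (erefl M2) charY).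
rewrite (H2_field_modeP s1 E G (erefl M1)) (H2_field_modeP (- s2) E G (erefl M2)).
by apply: eq_col4; rewrite !mxE /=; ring.
Qed.

(** * From the characteristic equation to the frequencies *)

Lemma imaginary_root (R : realType) (a c w : R) :
  (0 +i* w) ^+ 4 + a%:C * (0 +i* w) ^+ 2 + c%:C = 0 ->
  (w ^+ 2) ^+ 2 - a * w ^+ 2 + c = 0.
Proof.
have -> : (0 +i* w) ^+ 4 + a%:C * (0 +i* w) ^+ 2 + c%:C
          = ((w ^+ 2) ^+ 2 - a * w ^+ 2 + c)%:C.
  rewrite (_ : 4%N = (2 * 2)%N) // exprM.
  have -> : (0 +i* w) ^+ 2 = (- w ^+ 2)%:C.
    by apply/eqP; rewrite eq_complex expr2 /=; apply/andP; split;
       apply/eqP; ring.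
  by rewrite -rmorphXn -rmorphM -!rmorphD /= sqrrN mulrN.
by move/eqP; rewrite eq_complex /= => /andP[/eqP].
Qed.

Lemma Vieta_quadratic (R : realType) (a c X Y : R) :
  X != Y -> X ^+ 2 - a * X + c = 0 -> Y ^+ 2 - a * Y + c = 0 ->
  X + Y = a /\ X * Y = c.
Proof.
move=> XY rX rY.
have sXY : X + Y = a.
  have /eqP : (X - Y) * (X + Y - a) = 0.
    transitivity ((X ^+ 2 - a * X + c) - (Y ^+ 2 - a * Y + c)); first by ring.
    by rewrite rX rY subrr.
  by rewrite mulf_eq0 subr_eq0 (negPf XY) /= subr_eq0 => /eqP.
split=> //; apply/eqP; rewrite -subr_eq0 -oppr_eq0 -rX -sXY.
by apply/eqP; ring.
Qed.

(** The choice [delta = 1 / 2] gives [A2 > - 1 / 2], that is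
    [4 * n ^+ 2 > 1], and [1] bounds [w1 ^+ 2 - w2 ^+ 2]. *)
Theorem mainTheorem1 (R : realType) :
  exists delta : R, 0 < delta /\
  forall mu eps A2 W1 n w1 w2 : R,
  0 < mu -> mu <= 1 / 2 ->
  `|eps| < delta -> `|A2| < delta -> `|W1| < delta ->
  0 < n -> n ^+ 2 = 1 + 3 / 2 * A2 ->
  let gamma := 1 - 2 * mu in
  let E := H2coefE gamma eps A2 n W1 in
  let F := H2coefF gamma eps A2 n W1 in
  let G := H2coefG gamma eps A2 n W1 in
  let c := 4 * E * F - G ^+ 2 + n ^+ 4 - 2 * n ^+ 2 * (E + F) in
  0 < 4 * (E + F + n ^+ 2) ^+ 2 - 4 * c ->
  (forall l : R[i],
     l ^+ 4 + (2 * (E + F + n ^+ 2))%:C * l ^+ 2 + c%:C = 0 <->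
     [\/ l = 0 +i* w1, l = 0 -i* w1, l = 0 +i* w2 | l = 0 -i* w2]) ->
  0 < w2 -> w2 < 1 / Num.sqrt 2 -> 1 / Num.sqrt 2 < w1 -> w1 < 1 ->
  exists J : 'M[R]_4,
    canonical J /\
    forall I1 I2 phi1 phi2 : R, 0 <= I1 -> 0 <= I2 ->
      H2 n E F G (J *m col4 (actionQ w1 I1 phi1) (actionQ w2 I2 phi2)
                            (actionP w1 I1 phi1) (actionP w2 I2 phi2))
      = w1 * I1 - w2 * I2.
Proof.
exists (1 / 2); split; first by lra.
move=> mu eps A2 W1 n w1 w2 _ _ _ A2_small _ n0 nA2 gamma E F G c _ roots.
move=> w20 w2s w1s w1_lt1; have w21 := lt_trans w2s w1s.
have w10 := lt_trans w20 w21.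
have YX : w2 ^+ 2 < w1 ^+ 2 by rewrite ltr_pXn2r ?nnegrE // ltW.
have X1 : w1 ^+ 2 < 1 by rewrite expr_lt1 // ltW.
have Y0 : 0 < w2 ^+ 2 by rewrite exprn_gt0.
have gap : w1 ^+ 2 - w2 ^+ 2 < 4 * n ^+ 2.
  by move: A2_small; rewrite ltr_norml nA2 => /andP[? _]; lra.
have root1 : (0 +i* w1) ^+ 4 + (2 * (E + F + n ^+ 2))%:C * (0 +i* w1) ^+ 2
             + c%:C = 0 by apply/roots; constructor 1.
have root2 : (0 +i* w2) ^+ 4 + (2 * (E + F + n ^+ 2))%:C * (0 +i* w2) ^+ 2
             + c%:C = 0 by apply/roots; constructor 3.
have neqXY : w1 ^+ 2 != w2 ^+ 2 by rewrite gt_eqF.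
have [sXY pXY] :=
  Vieta_quadratic neqXY (imaginary_root root1) (imaginary_root root2).
have [J canJ fieldJ] := normal_form_exists n0 w20 w21 gap sXY pXY.
exists J; split=> // I1 I2 phi1 phi2 I1_ge0 I2_ge0.
by rewrite (H2_canonical canJ fieldJ) !col4E !oscillator_energy.
Qed.
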